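(* The proof system $\mathbf{EMN}^\circ$ is sound and strongly complete with respect to the class of $(mn)$-frames.
   Context: Fix a nonempty set $\mathbf{P}$ of propositional variables, $p\in\mathbf{P}$. $\mathcal{L}(\bullet)$: $\varphi::=p\mid\neg\varphi\mid\varphi\land\varphi\mid\bullet\varphi$; other Boolean connectives (including $\top$) are defined as usual and $\circ\varphi$ abbreviates $\neg\bullet\varphi$. A neighborhood frame is $\langle S,N\rangle$ with $S$ a nonempty set and $N:S\to\mathcal{P}(\mathcal{P}(S))$; a model $\mathcal{M}=\langle S,N,V\rangle$ based on it adds $V:\mathbf{P}\to\mathcal{P}(S)$. With $\varphi^{\mathcal{M}}=\{s\in S\mid\mathcal{M},s\vDash\varphi\}$: $\mathcal{M},s\vDash p$ iff $s\in V(p)$; Boolean connectives as usual; $\mathcal{M},s\vDash\bullet\varphi$ iff $s\in\varphi^{\mathcal{M}}$ and $\varphi^{\mathcal{M}}\notin N(s)$. An $(mn)$-frame is one where, for all $s\in S$: $(m)$ $X\in N(s)$ and $X\subseteq Y\subseteq S$ imply $Y\in N(s)$; and $(n)$ $S\in N(s)$. The proof system $\mathbf{EMN}^\circ$ for $\mathcal{L}(\bullet)$ has as axioms all instances of propositional tautologies, all instances of $\circ\texttt{E}$: $\bullet\varphi\to\varphi$ and $\circ\texttt{M}$: $\circ\varphi\land\varphi\to\circ(\varphi\lor\psi)$, and $\circ\texttt{N}$: $\circ\top$; its rules are modus ponens and $\texttt{RE}\circ$: from $\varphi\leftrightarrow\psi$ infer $\circ\varphi\leftrightarrow\circ\psi$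 (applied to theorems). Sound with respect to a class of frames: every theorem is true at every state of every model based on a frame in the class. Strongly complete: for every set $\Gamma\cup\{\varphi\}$ of formulas, if $\varphi$ is true at every state, in every model based on a frame in the class, at which all of $\Gamma$ is true, then $\vdash\bigwedge\Gamma_0\to\varphi$ for some finite $\Gamma_0\subseteq\Gamma$ (equivalently, every consistent set is satisfiable in a model based on a frame in the class). *)

(* Defs.v *)
From Stdlib Require List.
From mathcomp Require Import all_boot.
From mathcomp Require Import classical_sets.

Set Implicit Arguments.
Unset Strict Implicit.
Unset Printing Implicit Defensive.

Local Open Scope classical_set_scope.

Inductive form (P : Type) : Type :=
| Var of P
| Neg of form P
| And of form P & form P
| Bullet of form P.

Arguments Var {P} _.

Section Connectives.
Variable P : Type.
Implicit Types phi psi : form P.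

Definition Or phi psi := Neg (And (Neg phi) (Neg psi)).
Definition Imp phi psi := Neg (And phi (Neg psi)).
Definition Iff phi psi := And (Imp phi psi) (Imp psi phi).
Definition Circ phi := Neg (Bullet phi).

(* The language has no primitive constant, so Top is built from a fixed
   variable; such a variable exists because P is nonempty. *)
Definition Top (p0 : P) : form P := Or (Var p0) (Neg (Var p0)).

Definition BigAnd (p0 : P) (l : seq (form P)) : form P :=
  foldr (@And P) (Top p0) l.

End Connectives.

(* Propositional schemas have their own, countably infinite, supply of letters:
   P may be finite, so tautologies over P alone would have too few instances. *)
Inductive pform : Type :=
| PVar of nat
| PNeg of pform
| PAnd of pform & pform.

Fixpoint peval (v : nat -> bool) (a : pform) : bool :=
  match a with
  | PVar n => v n
  | PNeg b => ~~ peval v b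
  | PAnd b c => peval v b && peval v c
  end.

Definition tautology (a : pform) : Prop := forall v, peval v a.

Fixpoint instance (P : Type) (sigma : nat -> form P) (a : pform) : form P :=
  match a with
  | PVar n => sigma n
  | PNeg b => Neg (instance sigma b)
  | PAnd b c => And (instance sigma b) (instance sigma c)
  end.

Inductive EMN (P : Type) (p0 : P) : form P -> Prop :=
| EMN_taut a sigma : tautology a -> EMN p0 (instance sigma a)
| EMN_E phi : EMN p0 (Imp (Bullet phi) phi)
| EMN_M phi psi : EMN p0 (Imp (And (Circ phi) phi) (Circ (Or phi psi)))
| EMN_N : EMN p0 (Circ (Top p0))
| EMN_MP phi psi : EMN p0 phi -> EMN p0 (Imp phi psi) -> EMN p0 psi
| EMN_RE phi psi : EMN p0 (Iff phi psi) -> EMN p0 (Iff (Circ phi) (Circ psi)).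

Record frame : Type := Frame {
  state : Type;
  state_nonempty : inhabited state;
  nbh : state -> set (set state)
}.

Record model (P : Type) : Type := Model {
  model_frame : frame;
  valuation : P -> set (state model_frame)
}.

Fixpoint sat (P : Type) (M : model P) (s : state (model_frame M))
    (phi : form P) {struct phi} : Prop :=
  match phi with
  | Var p => valuation p s
  | Neg psi => ~ sat s psi
  | And psi chi => sat s psi /\ sat s chi
  | Bullet psi => sat s psi /\ ~ nbh s [set t | sat t psi]
  end.

Definition mn_frame (F : frame) : Prop :=
  forall s : state F,
    (forall X Y : set (state F), nbh s X -> X `<=` Y -> nbh s Y) /\
    nbh s setT.

Definition sound (P : Type) (p0 : P) (C : frame -> Prop) : Prop :=
  forall phi : form P, EMN p0 phi ->
  forall M : model P, C (model_frame M) ->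
  forall s : state (model_frame M), sat s phi.

Definition strongly_complete (P : Type) (p0 : P) (C : frame -> Prop) : Prop :=
  forall (Gamma : set (form P)) (phi : form P),
    (forall M : model P, C (model_frame M) ->
     forall s : state (model_frame M),
       (forall psi, Gamma psi -> sat s psi) -> sat s phi) ->
    exists Gamma0 : seq (form P),
      (forall psi, List.In psi Gamma0 -> Gamma psi) /\
      EMN p0 (Imp (BigAnd p0 Gamma0) phi).

(* Main.v *)
(** Completeness uses a canonical model whose states are the maximal consistent
    sets, with [X] a neighborhood of [s] when [X] includes the proof set of some
    [psi] such that [psi] and [Circ psi] belong to [s]. Closing upwards is
    harmless: if the proof set of [psi] is included in that of [phi], then [phi]
    is provably equivalent to [Or psi phi], so axiom M and rule RE put
    [Circ phi] in [s]. Axiom N makes the whole space a neighborhood. *)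

From Stdlib Require List.
From mathcomp Require Import all_boot.
From mathcomp Require Import boolp classical_sets.
Require Import Defs.

Set Implicit Arguments.
Unset Strict Implicit.
Unset Printing Implicit Defensive.

Local Open Scope classical_set_scope.

Section EMN.
Variables (P : Type) (p0 : P).
Implicit Types (a b phi psi : form P) (G D : set (form P)).
Implicit Types l : seq (form P).

(** * Propositional reasoning inside the proof system *)

Definition boolean_valuation (f : form P -> bool) : Prop :=
  (forall a, f (Neg a) = ~~ f a) /\ (forall a b, f (And a b) = f a && f b).

(** Propositional logic does not look inside [Bullet], so a formula [Bullet a] counts as an atom,
    like a variable. *)
Fixpoint atoms phi : seq (form P) :=
  match phi with
  | Neg a => atoms a
  | And a b => atoms a ++ atoms b
  | _ => [:: phi]
  end.

(** The letter of an atom is its position in [l]. The alias [{classic form P}] supplies the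
    decidable equality that [index] requires, for an arbitrary type [P]. *)
Fixpoint schema (l : seq {classic form P}) phi : pform :=
  match phi with
  | Neg a => PNeg (schema l a)
  | And a b => PAnd (schema l a) (schema l b)
  | _ => PVar (index (phi : {classic form P}) l)
  end.

Lemma instance_schema (l : seq {classic form P}) phi :
  {subset (atoms phi : seq {classic form P}) <= l} ->
  instance (nth (Top p0) l) (schema l phi) = phi.
Proof.
elim: phi => [p|a IHa|a IHa b IHb|a _] /= sub.
- by apply: (@nth_index {classic form P}); apply: sub; rewrite mem_head.
- by rewrite IHa.
- rewrite IHa ?IHb // => x xl; apply: sub.
    by rewrite (@mem_cat {classic form P}) xl orbT.
  by rewrite (@mem_cat {classic form P}) xl.
- by apply: (@nth_index {classic form P}); apply: sub; rewrite mem_head.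
Qed.

(* A valuation [v] of the letters of a schema of [phi] extends to all formulas
   by evaluating their own schemas. *)
Lemma EMN_valid phi :
  (forall f, boolean_valuation f -> f phi) -> EMN p0 phi.
Proof.
move=> valid; rewrite -(@instance_schema (atoms phi) phi) //.
apply: EMN_taut => v.
exact: (valid (fun a => peval v (schema (atoms phi) a))).
Qed.

Lemma EMN_valid1 a phi :
  EMN p0 a -> (forall f, boolean_valuation f -> f a -> f phi) -> EMN p0 phi.
Proof.
move=> pa valid; apply: (EMN_MP pa); apply: EMN_valid => f fP.
have := valid f fP; have [fN fA] := fP.
by rewrite /Imp !(fN, fA); case: (f a) => //= ->.
Qed.

Lemma EMN_valid2 a b phi :
  EMN p0 a -> EMN p0 b ->
  (forall f, boolean_valuation f -> f a -> f b -> f phi) -> EMN p0 phi.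
Proof.
move=> pa pb valid; apply: (EMN_MP pb).
apply: (EMN_valid1 pa) => f fP fa; have := valid f fP fa; have [fN fA] := fP.
by rewrite /Imp !(fN, fA); case: (f b) => //= ->.
Qed.

Lemma valuation_Imp f a b : boolean_valuation f -> f (Imp a b) = (f a ==> f b).
Proof. by case=> fN fA; rewrite /Imp !(fN, fA); case: (f a); case: (f b). Qed.

Lemma valuation_Or f a b : boolean_valuation f -> f (Or a b) = f a || f b.
Proof. by case=> fN fA; rewrite /Or !(fN, fA); case: (f a); case: (f b). Qed.

Lemma valuation_Top f : boolean_valuation f -> f (Top p0).
Proof. by move=> fP; rewrite (valuation_Or _ _ fP) fP.1 orbN. Qed.

Lemma valuation_BigAnd_cat f l1 l2 : boolean_valuation f ->
  f (BigAnd p0 (l1 ++ l2)) = f (BigAnd p0 l1) && f (BigAnd p0 l2).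
Proof.
move=> fP; elim: l1 => [|a l1 IH] /=; first by rewrite (valuation_Top fP).
by rewrite !fP.2 IH andbA.
Qed.

(** * Derivability from a set of hypotheses *)

Definition derives G phi : Prop :=
  exists l, (forall psi, List.In psi l -> G psi) /\
    EMN p0 (Imp (BigAnd p0 l) phi).

Lemma derives_theorem G phi : EMN p0 phi -> derives G phi.
Proof.
move=> pphi; exists [::]; split=> //; apply: (EMN_valid1 pphi) => f fP fphi.
by rewrite (valuation_Imp _ _ fP) fphi implybT.
Qed.

Lemma derives_hyp G phi : G phi -> derives G phi.
Proof.
move=> Gphi; exists [:: phi]; split=> [psi [<-|[]] //|].
apply: EMN_valid => f fP; rewrite (valuation_Imp _ _ fP) /= fP.2.
by case: (f phi); rewrite ?implybT.
Qed.

Lemma derives_MP G phi psi :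
  derives G phi -> derives G (Imp phi psi) -> derives G psi.
Proof.
move=> [l1 [G1 p1]] [l2 [G2 p2]]; exists (l1 ++ l2); split.
  by move=> a /(@List.in_app_or _ l1 l2) [/G1|/G2].
apply: (EMN_valid2 p1 p2) => f fP; rewrite !(valuation_Imp _ _ fP).
rewrite (valuation_BigAnd_cat _ _ fP).
by case: (f (BigAnd p0 l1)); case: (f (BigAnd p0 l2)) => //= ->.
Qed.

Lemma derives_valid1 G a phi : derives G a ->
  (forall f, boolean_valuation f -> f a -> f phi) -> derives G phi.
Proof.
move=> da valid; apply: (derives_MP da); apply: derives_theorem.
apply: EMN_valid => f fP; rewrite (valuation_Imp _ _ fP).
by apply/implyP; apply: valid.
Qed.

Lemma derives_valid2 G a b phi : derives G a -> derives G b ->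
  (forall f, boolean_valuation f -> f a -> f b -> f phi) -> derives G phi.
Proof.
move=> da db valid; apply: (derives_MP db); apply: (derives_valid1 da) => f fP fa.
by rewrite (valuation_Imp _ _ fP); apply/implyP; apply: valid.
Qed.

(** Induction on the list of hypotheses, with [phi] general: the head [a] moves into the conclusion
    as [Imp a phi]. Afterwards it is discharged if it lies in [G], and contracted with [psi] if it
    equals [psi]. *)
Lemma deduction G psi phi :
  derives (G `|` [set psi]) phi -> derives G (Imp psi phi).
Proof.
case=> l [Gl pl]; elim: l phi Gl pl => [|a l IH] phi Gl pl.
  apply: derives_theorem; apply: (EMN_valid1 pl) => f fP.
  by rewrite 2!(valuation_Imp _ _ fP) (valuation_Top fP) /= => ->; rewrite implybT.
have: derives G (Imp psi (Imp a phi)).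
  apply: IH => [b bl|]; first by apply: Gl; right.
  apply: (EMN_valid1 pl) => f fP; rewrite !(valuation_Imp _ _ fP) /= fP.2.
  by case: (f a); case: (f (BigAnd p0 l)).
case: (Gl a (or_introl erefl)) => [Ga|->] d.
- apply: (derives_valid2 d (derives_hyp Ga)) => f fP.
  by rewrite !(valuation_Imp _ _ fP); case: (f psi) => //= + fa; rewrite fa.
- apply: (derives_valid1 d) => f fP.
  by rewrite !(valuation_Imp _ _ fP); case: (f psi).
Qed.

(** * Maximal consistent sets and Lindenbaum's lemma *)

Definition maximal_consistent D : Prop :=
  (forall psi, derives D psi -> D psi) /\ (forall psi, D (Neg psi) <-> ~ D psi).

(** Finitely many members of a chain have a largest one. The alternative [set0] covers lists that
    take nothing from the chain, which may itself be empty. *)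
Lemma chain_finite_subset G (F : set (set (form P))) l :
  total_on F subset ->
  (forall a, List.In a l -> (G `|` \bigcup_(X in F) X) a) ->
  exists X, (F X \/ X = set0) /\ forall a, List.In a l -> (G `|` X) a.
Proof.
move=> chain; elim: l => [_|a l IH sub]; first by exists set0; split; [right|].
have [b bl|X [FX lX]] := IH; first by apply: sub; right.
case: (sub a (or_introl erefl)) => [Ga|[Y FY Ya]].
  by exists X; split=> // b [<-|/lX //]; left.
have [XY|YX] : X `<=` Y \/ Y `<=` X.
  by case: FX => [FX|->]; [exact: chain | left].
- by exists Y; split; [left|move=> b [<-|/lX [Gb|/XY Yb]]; [right|left|right]].
- by exists X; split=> // b [<-|/lX //]; right; apply: YX.
Qed.

Lemma lindenbaum G phi : ~ derives G phi ->
  exists D, [/\ maximal_consistent D, G `<=` D & ~ D phi].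
Proof.
move=> Gphi.
(* Zorn's lemma runs over the additions [A] to [G] rather than over supersets of [G], so that the
   empty chain, with union [set0], is covered by the assumption on [G]. *)
have [F FQ chain|A [Aphi Amax]] :=
  @Zorn_bigcup _ [set A : set (form P) | ~ derives (G `|` A) phi].
  move=> [l [sub pl]]; have [X [[FX|X0] lX]] := chain_finite_subset chain sub.
    by apply: (FQ _ FX); exists l.
  by apply: Gphi; exists l; split=> // a /lX [//|]; rewrite X0.
pose D := G `|` A.
(* By maximality, any formula outside [D] makes [phi] derivable once added. *)
have ext psi : ~ D psi -> derives (D `|` [set psi]) phi.
  move=> Dpsi; rewrite -setUA; apply: contrapT; apply: Amax.
  split; first exact: subsetUl.
  by move=> /(_ psi (or_intror erefl)) Apsi; apply: Dpsi; right.
have closed psi : derives D psi -> D psi.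
  move=> dpsi; apply: contrapT => /ext /deduction d.
  exact: Aphi (derives_MP dpsi d).
exists D; split=> [||Dphi]; last exact: Aphi (derives_hyp Dphi).
- split=> // psi; split=> [Dn Dpsi|Dpsi].
    apply: Aphi; apply: (derives_valid2 (derives_hyp Dn) (derives_hyp Dpsi)).
    by move=> f fP; rewrite fP.1 => /negP.
  (* If [psi] and [Neg psi] were both outside [D], each would imply [phi] over [D], and so [D] would
     derive [phi]. *)
  apply: contrapT => /ext /deduction dn; apply: Aphi.
  apply: (derives_valid2 (deduction (ext _ Dpsi)) dn) => f fP.
  by rewrite !(valuation_Imp _ _ fP) fP.1; case: (f psi).
- exact: subsetUl.
Qed.

Section MaximalConsistent.
Variables (D : set (form P)) (maxD : maximal_consistent D).

Lemma mc_theorem phi : EMN p0 phi -> D phi.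
Proof. by move=> pphi; apply: maxD.1; apply: derives_theorem. Qed.

Lemma mc_MP phi psi : D phi -> D (Imp phi psi) -> D psi.
Proof.
move=> Dphi Di; apply: maxD.1.
exact: derives_MP (derives_hyp Dphi) (derives_hyp Di).
Qed.

Lemma mc_And phi psi : D (And phi psi) <-> D phi /\ D psi.
Proof.
split=> [/derives_hyp d|[/derives_hyp d1 /derives_hyp d2]].
  by split; apply: maxD.1; apply: (derives_valid1 d) => f fP; rewrite fP.2 => /andP [].
by apply: maxD.1; apply: (derives_valid2 d1 d2) => f fP f1 f2; rewrite fP.2 f1.
Qed.

Lemma mc_Circ_mono psi phi :
  EMN p0 (Imp psi phi) -> D psi -> D (Circ psi) -> D (Circ phi).
Proof.
move=> pi Dpsi Dcirc.
have equiv : EMN p0 (Iff (Or psi phi) phi).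
  apply: (EMN_valid1 pi) => f [fN fA]; rewrite /Iff /Imp /Or !(fN, fA).
  by case: (f psi); case: (f phi).
have /mc_And [+ _] := mc_theorem (EMN_RE equiv).
apply: mc_MP; apply: mc_MP _ (mc_theorem (EMN_M p0 psi phi)).
exact/mc_And.
Qed.

End MaximalConsistent.

(** * The canonical model *)

Definition canonical_state : Type := {D : set (form P) | maximal_consistent D}.

Definition proof_set phi : set canonical_state := [set t | sval t phi].

(** Otherwise Lindenbaum's lemma extends the singleton of [psi] to a state that omits [phi]. *)
Lemma proof_set_subset psi phi :
  proof_set psi `<=` proof_set phi -> EMN p0 (Imp psi phi).
Proof.
move=> sub; have: derives [set psi] phi.
  apply: contrapT => /lindenbaum [D [maxD psiD]]; apply.
  by apply: (sub (exist _ D maxD)); apply: psiD.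
(* Hypotheses drawn from [set0] can only form the empty list. *)
rewrite -(set0U [set psi]) => /deduction [[|a l] [l0 pl]]; last first.
  by case: (l0 a (or_introl erefl)).
apply: (EMN_valid1 pl) => f fP.
by rewrite (valuation_Imp _ _ fP) (valuation_Top fP).
Qed.

Definition canonical_nbh (s : canonical_state) : set (set canonical_state) :=
  [set X | exists psi, [/\ sval s psi, sval s (Circ psi) & proof_set psi `<=` X]].

(** The argument [s] witnesses that there is a state. *)
Definition canonical_frame (s : canonical_state) : frame :=
  Frame (inhabits s) canonical_nbh.

Definition canonical_model (s : canonical_state) : model P :=
  @Model P (canonical_frame s) (fun p => proof_set (Var p)).

Lemma canonical_mn s : mn_frame (canonical_frame s).
Proof.
move=> t; split=> [X Y [psi [t1 t2 sub]] XY|].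
  by exists psi; split=> //; apply: subset_trans XY.
exists (Top p0); split=> //; apply: (mc_theorem (svalP t)); last exact: EMN_N.
by apply: EMN_valid => f /valuation_Top.
Qed.

Lemma canonical_Bullet (s : canonical_state) phi :
  sval s (Bullet phi) <-> sval s phi /\ ~ canonical_nbh s (proof_set phi).
Proof.
have maxs := svalP s; split=> [sb|[sphi nnbh]].
  split; first exact: (mc_MP maxs sb) (mc_theorem maxs (EMN_E p0 phi)).
  (* A neighborhood witness [psi] would put [Circ phi], the negation of [Bullet phi], in [s]. *)
  move=> [psi [s1 s2 /proof_set_subset pi]].
  by have /maxs.2 := mc_Circ_mono maxs pi s1 s2.
(* Without [Bullet phi], the state contains [Circ phi], and [phi] itself witnesses the
   neighborhood. *)
apply: contrapT => /maxs.2 scirc; apply: nnbh; exists phi; split=> //.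
Qed.

Lemma truth s phi (t : canonical_state) :
  @sat P (canonical_model s) t phi <-> sval t phi.
Proof.
elim: phi t => [p|a IH|a IHa b IHb|a IH] t //=.
- by rewrite IH (svalP t).2.
- by rewrite IHa IHb (mc_And (svalP t)).
(* The induction hypothesis holds at every state, so it identifies the whole truth set of [a]. *)
- have -> : [set u | @sat P (canonical_model s) u a] = proof_set a.
    by apply/seteqP; split=> u /IH.
  by rewrite IH canonical_Bullet.
Qed.

(** * Soundness *)

Lemma sat_instance (M : model P) (s : state (model_frame M)) sigma (A : pform) :
  sat s (instance sigma A) <-> peval (fun n => `[< sat s (sigma n) >]) A.
Proof.
elim: A => [n|A IH|A IHA B IHB] /=; first by rewrite asboolE.
- by rewrite IH; split=> /negP.
- by rewrite IHA IHB; split=> /andP.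
Qed.

Lemma sat_Imp (M : model P) (s : state (model_frame M)) phi psi :
  sat s (Imp phi psi) <-> (sat s phi -> sat s psi).
Proof.
split=> /= [h sphi|h [/h]//].
by apply: contrapT => npsi; apply: h.
Qed.

Lemma EMN_sound : sound p0 mn_frame.
Proof.
move=> phi d M mnM; elim: phi / d =>
  [a sigma taut|phi|phi psi||phi psi _ IH1 _ IH2|phi psi _ IH] s.
- by apply/sat_instance.
- by apply/sat_Imp => -[].
- apply/sat_Imp => -[circ sphi] [_]; apply.
  (* Condition (m), from the truth set of [phi] up to that of [Or phi psi]. *)
  apply: (proj1 (mnM s) [set t | sat t phi]) => [|t tphi [+ _]]; last exact.
  by apply: contrapT => nphi; apply: circ.
- move=> [_]; apply; have -> : [set t : state (model_frame M) | sat t (Top p0)] = setT.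
    by apply/seteqP; split=> t // _ [n1 n2]; apply: n2.
  exact: (mnM s).2.
- by have /sat_Imp := IH2 s; apply.
(* The rule needs the premise at all states of [M]: only then are the two truth sets equal, and
   neighborhoods of [s] together. *)
- have eqv (t : state (model_frame M)) : sat t phi <-> sat t psi.
    by have [/sat_Imp h1 /sat_Imp h2] := IH t.
  have eqs : [set t : state (model_frame M) | sat t phi] = [set t | sat t psi].
    by apply/seteqP; split=> t /eqv.
  have [h1 h2] : sat s (Circ phi) <-> sat s (Circ psi) by rewrite /= eqs eqv.
  by split; apply/sat_Imp.
Qed.

(** * Strong completeness *)

Lemma EMN_strongly_complete : strongly_complete p0 mn_frame.
Proof.
move=> Gamma phi valid; change (derives Gamma phi).
(* If [Gamma] does not derive [phi], some state [D] includes [Gamma] and omits [phi]; validity at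
   [D] in the canonical model contradicts this. *)
apply: contrapT => /lindenbaum [D [maxD GD]]; apply.
pose s : canonical_state := exist _ D maxD.
have /truth : @sat P (canonical_model s) s phi; last exact.
apply: (valid (canonical_model s) (@canonical_mn s)) => psi /GD Dpsi.
exact: (truth s psi s).2.
Qed.

End EMN.

Theorem theorem5p14 (P : Type) (p0 : P) :
  sound p0 mn_frame /\ strongly_complete p0 mn_frame.
Proof. by split; [exact: EMN_sound | exact: EMN_strongly_complete]. Qed.
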